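(* Let $P$ be an $r$-differential poset and $Q$ an $s$-differential poset, with rank sizes $p_n$ and $q_n$ respectively. Suppose that $\Delta q_n\ge\Delta q_{n-1}$ for all $n\ge2$, and that all the down maps of at least one of $P$, $Q$ are surjective (over $\mathbb{Z}$). Then for the Cartesian product poset $P\times Q$ and every $n\ge0$, the matrix $[DU_n]+xI$ (where $DU_n$ is computed in $P\times Q$ and $I$ is the identity of size equal to the $n$-th rank size of $P\times Q$) has Smith normal form over $\mathbb{Z}[x]$.
   Context: For a positive integer $r$, a poset $P$ is $r$-differential if: (D1) $P$ is graded, locally finite, has all rank sizes finite and a unique minimum element; (D2) if two distinct elements of $P$ both cover exactly $k$ common elements, then exactly $k$ elements cover them both; (D3) if an element covers $k$ elements then it is covered by exactly $k+r$ elements. $P_n$ is the $n$-th rank (empty for $n<0$), $p_n=|P_n|$, $\Delta p_n=p_n-p_{n-1}$. $\mathbb{Z}P_n$ is the free $\mathbb{Z}$-module with basis $P_n$; $U_n:\mathbb{Z}P_n\to\mathbb{Z}P_{n+1}$ sends an element to the sum of all elements covering it, $D_n:\mathbb{Z}P_n\to\mathbb{Z}P_{n-1}$ sends an element to the sum of all elements it covers, $DU_n=D_{n+1}U_n$, and $[DU_n]$ is its matrix in the standard basis. $P\times Q$ is the product poset with componentwise order (it is $(r+s)$-differential). A matrix over a commutative ring $R$ has Smith normal form over $R$ if it can be multiplied on both sides by invertible matrices over $R$ to obtain a diagonal matrix whose diagonal entries satisfy $s_1\mid s_2\mid\cdots$. *)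

(* Defs.v *)
From HB Require Import structures.
From mathcomp Require Import all_boot all_order all_algebra.
Set Implicit Arguments. Unset Strict Implicit. Unset Printing Implicit Defensive.
Import Order.TTheory GRing.Theory Num.Theory.

(* A graded poset given by its ranks and its covering relation between
   consecutive ranks: elt n = P_n (a finite set), cov n x y <=> y covers x
   (x in P_n, y in P_{n+1}).  In a graded poset covers only occur between
   consecutive ranks, and the order is the reflexive-transitive closure. *)
Record gposet := GPoset {
  elt : nat -> finType;
  cov : forall n, elt n -> elt n.+1 -> bool }.

Arguments cov {g n}.

Definition ndown (P : gposet) (n : nat) : elt P n -> nat :=
  match n as m return elt P m -> nat with
  | 0 => fun _ => 0
  | m.+1 => fun x => #|[pred w : elt P m | cov w x]|
  end.

Definition ncommon_down (P : gposet) (n : nat) : elt P n -> elt P n -> nat :=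
  match n as m return elt P m -> elt P m -> nat with
  | 0 => fun _ _ => 0
  | m.+1 => fun x y => #|[pred w : elt P m | cov w x && cov w y]|
  end.

(* r-differential poset (D1)-(D3).  D1: graded with finite ranks (built in),
   unique minimum: P_0 is a singleton and every element of positive rank
   covers some element.  D2 only concerns elements of equal rank, since in a
   graded poset elements of different ranks have no common cover and cover no
   common element. *)
Definition differential (r : nat) (P : gposet) : Prop :=
  [/\ 0 < r,
      #|elt P 0| = 1,
      (forall n (y : elt P n.+1), exists x : elt P n, cov x y),
      (forall n (x y : elt P n), x != y ->
          #|[pred z : elt P n.+1 | cov x z && cov y z]| = ncommon_down x y)
    & (forall n (x : elt P n),
          #|[pred z : elt P n.+1 | cov x z]| = ndown x + r)].

Definition rksize (P : gposet) (n : nat) : nat := #|elt P n|.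

(* all down maps D_{n+1} : Z P_{n+1} -> Z P_n are surjective over Z
   (D_0 has target 0 and is trivially surjective). *)
Definition down_surjective (P : gposet) : Prop :=
  forall n (v : elt P n -> int), exists w : elt P n.+1 -> int,
    forall y : elt P n, v y = (\sum_(x : elt P n.+1 | cov y x) w x)%R.

Definition telt (P : gposet) := {n : nat & elt P n}.

Definition tcov (P : gposet) (u v : telt P) : bool :=
  [exists x : elt P (tag u), exists y : elt P (tag u).+1,
     [&& Tagged (elt P) x == u, Tagged (elt P) y == v & cov x y]].

Definition prod_elt (P Q : gposet) (n : nat) : finType :=
  {i : 'I_n.+1 & (elt P i * elt Q (n - i))%type}.

Definition prod_pair (P Q : gposet) (n : nat) (x : prod_elt P Q n)
  : telt P * telt Q :=
  (Tagged (elt P) (tagged x).1, Tagged (elt Q) (tagged x).2).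

Definition prod_cov (P Q : gposet) (n : nat)
  (x : prod_elt P Q n) (y : prod_elt P Q n.+1) : bool :=
  let u := prod_pair x in let v := prod_pair y in
  (tcov u.1 v.1 && (u.2 == v.2)) || ((u.1 == v.1) && tcov u.2 v.2).

Definition prod_poset (P Q : gposet) : gposet :=
  GPoset (@prod_cov P Q).

(* matrix of DU_n = D_{n+1} U_n in the standard basis (indexed via enum_val),
   with entries in Z[x]: entry (x,y) = coefficient of x in D U y
   = number of z in P_{n+1} covering both x and y. *)
Definition DUmx (P : gposet) (n : nat) : 'M[{poly int}]_#|elt P n| :=
  \matrix_(i, j) (#|[pred z : elt P n.+1 |
        cov (enum_val i) z && cov (enum_val j) z]|)%:R%R.

Definition rdvd (R : comNzRingType) (a b : R) : Prop := exists c : R, b = (c * a)%R.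

Definition has_SNF (R : comUnitRingType) (k : nat) (A : 'M[R]_k) : Prop :=
  exists (M N : 'M[R]_k),
    [/\ M \in unitmx, N \in unitmx,
        is_diag_mx (M *m A *m N)
      & forall i j : 'I_k, (i <= j)%N ->
          rdvd ((M *m A *m N) i i) ((M *m A *m N) j j)].

(* Main.v *)
Require Import Defs.
From mathcomp Require Import all_boot all_order all_algebra.
From mathcomp Require Import zify ring.
Import Order.TTheory GRing.Theory Num.Theory.

(** Let T be an r-differential poset with r > 1 whose down maps D are
    surjective and whose rank sizes t_n are strictly convex. Regard Z T_n as a
    Z[x]-module with x acting by - D U. Since D U = U D + r, a Smith form of D U
    on Z T_n yields one of D U on Z T_(n+1), provided that generators v of the
    cyclic summands in rank n lift through D to vectors which, together with
    some elements of ker D, form a basis of coker U. The lifting problem amounts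
    to perturbing a singular integer matrix H to a unimodular matrix H + F T,
    where the rows of H and T together span; this is solvable as soon as there
    are strictly more generators in rank n + 1 than in rank n, which is what
    strict convexity says from rank 1 on. In rank 1 the matrix is J + r, with J
    the all-ones matrix, and the generators are explicit.

    The product P x Q is such a poset, with r + s in place of r. Its up and down
    maps are sums of those of the factors, so in D U - U D the mixed terms
    cancel. Its rank sizes are the convolution p * q, whose second difference is
    that of q convolved with p, up to boundary terms. *)

Set Implicit Arguments.
Unset Strict Implicit.
Unset Printing Implicit Defensive.
Local Open Scope ring_scope.

(** * Row combinations *)

Section RowCombinations.
Variable K : pzRingType.

Definition row_comb m k n (A : 'M[K]_(m, n)) (B : 'M[K]_(k, n)) : Prop :=
  exists N : 'M[K]_(m, k), A = N *m B.

Lemma row_comb_refl m n (A : 'M[K]_(m, n)) : row_comb A A.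
Proof. by exists 1%:M; rewrite mul1mx. Qed.

Lemma row_comb_trans m k l n (B : 'M[K]_(k, n)) (A : 'M[K]_(m, n))
    (C : 'M[K]_(l, n)) : row_comb A B -> row_comb B C -> row_comb A C.
Proof. by move=> [N ->] [M ->]; exists (N *m M); rewrite mulmxA. Qed.

Lemma row_comb0 m k n (B : 'M[K]_(k, n)) : row_comb (0 : 'M_(m, n)) B.
Proof. by exists 0; rewrite mul0mx. Qed.

Lemma row_combD m k n (A A' : 'M[K]_(m, n)) (B : 'M[K]_(k, n)) :
  row_comb A B -> row_comb A' B -> row_comb (A + A') B.
Proof. by move=> [M ->] [N ->]; exists (M + N); rewrite mulmxDl. Qed.

Lemma row_combB m k n (A A' : 'M[K]_(m, n)) (B : 'M[K]_(k, n)) :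
  row_comb A B -> row_comb A' B -> row_comb (A - A') B.
Proof. by move=> [M ->] [N ->]; exists (M - N); rewrite mulmxBl. Qed.

Lemma row_combZ m k n (a : K) (A : 'M[K]_(m, n)) (B : 'M[K]_(k, n)) :
  row_comb A B -> row_comb (a *: A) B.
Proof. by move=> [M ->]; exists (a *: M); rewrite scalemxAl. Qed.

Lemma row_comb_mull l m k n (N : 'M[K]_(l, m)) (A : 'M[K]_(m, n))
    (B : 'M[K]_(k, n)) : row_comb A B -> row_comb (N *m A) B.
Proof. by move=> [M ->]; exists (N *m M); rewrite mulmxA. Qed.

Lemma row_comb_mulr m k n p (C : 'M[K]_(n, p)) (A : 'M[K]_(m, n))
    (B : 'M[K]_(k, n)) : row_comb A B -> row_comb (A *m C) (B *m C).
Proof. by move=> [M ->]; exists M; rewrite mulmxA. Qed.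

Lemma row_comb_colu m k l n (A : 'M[K]_(m, n)) (B : 'M[K]_(k, n))
    (C : 'M[K]_(l, n)) : row_comb A B -> row_comb A (col_mx B C).
Proof. by move=> [M ->]; exists (row_mx M 0); rewrite mul_row_col mul0mx addr0. Qed.

Lemma row_comb_cold m k l n (A : 'M[K]_(m, n)) (B : 'M[K]_(k, n))
    (C : 'M[K]_(l, n)) : row_comb A C -> row_comb A (col_mx B C).
Proof. by move=> [M ->]; exists (row_mx 0 M); rewrite mul_row_col mul0mx add0r. Qed.

Lemma col_mx_row_comb m k l n (A : 'M[K]_(m, n)) (B : 'M[K]_(k, n))
    (C : 'M[K]_(l, n)) : row_comb A C -> row_comb B C -> row_comb (col_mx A B) C.
Proof. by move=> [M ->] [N ->]; exists (col_mx M N); rewrite mul_col_mx. Qed.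

End RowCombinations.

Local Notation spanning A := (row_comb 1%:M A).

Lemma row_comb_spanning (K : pzRingType) m k n (A : 'M[K]_(k, m))
    (B : 'M[K]_(m, n)) : spanning A -> row_comb B (A *m B).
Proof. by move=> /(row_comb_mulr B); rewrite mul1mx. Qed.

#[local] Hint Resolve row_comb_refl row_comb0 row_combD row_combB row_combZ
  row_comb_mull row_comb_colu row_comb_cold col_mx_row_comb : row_comb.

Lemma row_comb_map (K L : pzRingType) (f : {rmorphism K -> L}) m k n
    (A : 'M[K]_(m, n)) (B : 'M[K]_(k, n)) :
  row_comb A B -> row_comb (map_mx f A) (map_mx f B).
Proof. by move=> [M ->]; exists (map_mx f M); rewrite map_mxM. Qed.

Lemma spanning_mul (K : pzRingType) m n p (A : 'M[K]_(m, n)) (B : 'M[K]_(n, p)) :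
  spanning A -> spanning B -> spanning (A *m B).
Proof.
by move=> spanA spanB; apply: row_comb_trans spanB (row_comb_spanning B spanA).
Qed.

Lemma spanning_of_quotient (K : pzRingType) t' m n t (U : 'M[K]_(t', t))
    (Uinv : 'M[K]_(t, t')) (L : 'M[K]_(t, m)) (M : 'M[K]_(m, t)) (V : 'M[K]_(n, t)) :
  Uinv *m U + L *m M = 1%:M -> spanning (V *m L) -> spanning (col_mx V U).
Proof.
move=> UULM [N NVL]; rewrite -UULM -[M]mul1mx NVL.
have -> : N *m (V *m L) *m M = N *m (V - V *m Uinv *m U).
  rewrite -!mulmxA; congr (N *m _).
  by rewrite -[X in _ = X - _]mulmx1 -UULM mulmxDr addrAC subrr add0r.
by auto 12 with row_comb.
Qed.

(** * Lifting generators over the integers *)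

Lemma unimodular_zero_rows n a (H : 'M[int]_(n, a)) :
  exists2 L : 'M[int]_n, L \in unitmx &
    forall i : 'I_n, (a <= i)%N -> row i (L *m H) = 0.
Proof.
have [L uL [R _ [d _ ->]]] := int_Smith_normal_form H.
exists (invmx L) => [|i le_ai]; first by rewrite unitmx_inv.
rewrite -mulmxA mulKmx // row_mul.
suff -> : row i (\matrix_(i, j) (d`_i *+ (i == j :> nat)) : 'M_(n, a)) = 0.
  by rewrite mul0mx.
apply/rowP => j; rewrite !mxE gtn_eqF ?mulr0n //.
exact: leq_trans (ltn_ord j) le_ai.
Qed.

Lemma left_inverse_split t' m t (W : 'M[int]_(t', t)) (D : 'M[int]_(t, t')) :
  W *m D = 1%:M -> (t' + m = t)%N ->
  exists (Z : 'M[int]_(m, t)) (S : 'M[int]_(t, m)),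
    [/\ Z *m D = 0, Z *m S = 1%:M & D *m W + S *m Z = 1%:M].
Proof.
move=> WD dim_t; case: t / dim_t W D WD => W D WD.
have [L uL zL] := unimodular_zero_rows D.
pose Z := dsubmx L; pose M := rsubmx (invmx L).
have ZD : Z *m D = 0.
  apply/row_matrixP => i; rewrite row0 mul_dsub_mx row_dsubmx.
  by apply: zL; rewrite /= leq_addr.
have ZM : Z *m M = 1%:M.
  have := mulmxV uL; rewrite -[L in L *m _]vsubmxK -[invmx L]hsubmxK mul_col_row.
  by rewrite (@scalar_mx_block _ t' m) => /eq_block_mx[].
exists Z, (M - D *m W *m M).
have ZS : Z *m (M - D *m W *m M) = 1%:M by rewrite mulmxBr !mulmxA ZD !mul0mx subr0.
have WS : W *m (M - D *m W *m M) = 0 by rewrite mulmxBr !mulmxA WD mul1mx subrr.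
split=> //; rewrite -mul_row_col; apply: mulmx1C.
by rewrite mul_col_row WD WS ZD ZS -scalar_mx_block.
Qed.

Lemma right_inverse_split t' m t (U : 'M[int]_(t', t)) (W : 'M[int]_(t, t')) :
  U *m W = 1%:M -> (t' + m = t)%N ->
  exists (L : 'M[int]_(t, m)) (M : 'M[int]_(m, t)),
    [/\ U *m L = 0, M *m L = 1%:M & W *m U + L *m M = 1%:M].
Proof.
move=> UW dim_t.
have [|Z [S [ZU ZS UWSZ]]] := @left_inverse_split _ m _ W^T U^T _ dim_t.
  by rewrite -trmx_mul UW trmx1.
exists Z^T, S^T; split; apply: trmx_inj.
- by rewrite trmx_mul trmxK ZU trmx0.
- by rewrite trmx_mul !trmxK ZS trmx1.
- by rewrite linearD /= !trmx_mul !trmxK UWSZ trmx1.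
Qed.

Lemma primitive_annihilator m n (A : 'M[int]_(m, n)) : (m < n)%N ->
  exists (c : 'cV[int]_n) (u : 'rV[int]_n), A *m c = 0 /\ u *m c = 1%:M.
Proof.
move=> lt_mn; have [L uL zL] := unimodular_zero_rows A^T.
pose i0 := Ordinal lt_mn; exists (row i0 L)^T, (col i0 (invmx L))^T.
split; apply: trmx_inj.
  by rewrite trmx_mul trmxK -row_mul zL // trmx0.
rewrite trmx_mul !trmxK trmx1 -row_mul colE mulmxA mulmxV // mul1mx.
by apply/matrixP => i j; rewrite !ord1 !mxE !eqxx.
Qed.

(* Since H has more rows than columns, a unimodular change of rows produces a
   zero row, which can host tau. *)
Lemma spanning_absorb_row n a (H : 'M[int]_(n, a)) (tau : 'rV[int]_a) :
  (a < n)%N -> spanning (col_mx H tau) ->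
  exists f : 'cV[int]_n, spanning (H + f *m tau).
Proof.
move=> lt_an spanHt; have [L uL zL] := unimodular_zero_rows H.
pose i0 := Ordinal lt_an; pose f := invmx L *m delta_mx i0 0 : 'cV[int]_n.
exists f; have tauE : row i0 L *m (H + f *m tau) = tau.
  rewrite -row_mul mulmxDr linearD /= zL // add0r mulmxA mulKVmx //.
  rewrite row_mul rowE mul_delta_mx.
  by apply/rowP=> j; rewrite mxE big_ord1 !mxE eqxx mul1r.
have taus : row_comb tau (H + f *m tau) by exists (row i0 L).
apply: row_comb_trans spanHt (col_mx_row_comb _ taus).
by rewrite -[X in row_comb X _](addrK (f *m tau)); auto 12 with row_comb.
Qed.

Lemma spanning_absorb_rows k n a (H : 'M[int]_(n, a)) (T : 'M[int]_(k, a)) :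
  (a < n)%N -> spanning (col_mx H T) ->
  exists F : 'M[int]_(n, k), spanning (H + F *m T).
Proof.
move=> lt_an; elim: k H T => [|k IHk] H T.
  move=> spanHT; exists 0; rewrite mul0mx addr0; apply: row_comb_trans spanHT _.
  by rewrite [T]flatmx0; auto 12 with row_comb.
rewrite -[T](@vsubmxK _ 1 k); set tau := usubmx _; set T1 := dsubmx _ => spanHT.
have [|f] := @spanning_absorb_row (n + k) a (col_mx H T1) tau (ltn_addr _ lt_an).
  apply: row_comb_trans spanHT (col_mx_row_comb _ _); first by auto 12 with row_comb.
  by apply: (@col_mx_row_comb _ 1 k); auto 12 with row_comb.
rewrite -[f]vsubmxK mul_col_mx add_col_mx => /IHk[F spanF].
exists (row_mx (usubmx f + F *m dsubmx f) F).
suff -> : H + row_mx (usubmx f + F *m dsubmx f) F *m col_mx tau T1 =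
  H + usubmx f *m tau + F *m (T1 + dsubmx f *m tau) by [].
by rewrite mul_row_col mulmxDl mulmxDr mulmxA -!addrA [F *m T1 + _]addrC.
Qed.

(* A primitive vector c killed by H forces the row span of T to contain some
   tau with tau *m c = 1; modulo tau there is one column less, so the rows of T
   can be absorbed, and the tau-coordinate is free to complete the result to a
   square unimodular matrix. *)
Lemma spanning_perturbation n k (H : 'M[int]_n) (T : 'M[int]_(k, n))
    (c : 'cV[int]_n) (u : 'rV[int]_n) :
  H *m c = 0 -> u *m c = 1%:M -> spanning (col_mx H T) ->
  exists F : 'M[int]_(n, k), spanning (H + F *m T).
Proof.
case: n H T c u => [|a] H T c u Hc uc spanHT.
  by exists 0, 0; rewrite [LHS]flatmx0 [RHS]flatmx0.
have [N] := spanHT; rewrite -[N]hsubmxK mul_row_col.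
set N1 := lsubmx N; set N2 := rsubmx N => spanHTE.
pose tau := u *m N2 *m T.
have tauc : tau *m c = 1%:M.
  rewrite -uc -[u in RHS]mulmx1 spanHTE mulmxDr mulmxDl -!mulmxA Hc !mulmx0 add0r.
  by rewrite !mulmxA.
have [Z [S [_ ZS ctSZ]]] := @left_inverse_split 1 a a.+1 tau c tauc erefl.
have mod_tau p (X : 'M[int]_(p, a.+1)) : X = X *m c *m tau + X *m S *m Z.
  by rewrite -!mulmxA -mulmxDr ctSZ mulmx1.
have [|F spanF] := @spanning_absorb_rows k a.+1 a (H *m S) (T *m S) (ltnSn _).
  by rewrite -mul_col_mx -ZS; apply/row_comb_mull/row_comb_spanning.
have [M /esym MG] := spanF.
have [Y [f [_ _ GMfY]]] := @left_inverse_split a 1 a.+1 _ _ MG (addn1 a).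
exists (F + (f - F *m T *m c) *m (u *m N2)).
suff -> : H + (F + (f - F *m T *m c) *m (u *m N2)) *m T =
    row_mx f (H *m S + F *m (T *m S)) *m col_mx tau Z.
  apply: spanning_mul; last by exists (row_mx c S); rewrite mul_row_col.
  by exists (col_mx Y M); apply/esym/(@mulmx1C _ (1 + a)); rewrite mul_row_col addrC.
rewrite mul_row_col [in LHS]mulmxDl -[(f - _) *m _ *m T]mulmxA -/tau mulmxBl.
rewrite {1}(mod_tau _ (F *m T)) [F *m T *m c *m _ + _ + _]addrC subrKA.
by rewrite [H in LHS](mod_tau _ H) Hc !mul0mx add0r mulmxDl !mulmxA addrCA.
Qed.

Lemma lift_generators m' d t' t (U Dinv : 'M[int]_(t', t))
    (Uinv D : 'M[int]_(t, t')) (V' : 'M[int]_(m', t')) :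
  U *m Uinv = 1%:M -> Dinv *m D = 1%:M -> spanning (col_mx V' (U *m D)) ->
  (t' + (d.+1 + m') = t)%N ->
  exists2 V : 'M[int]_(d.+1 + m', t),
    V *m D = col_mx 0 V' & spanning (col_mx V U).
Proof.
move=> UUinv DinvD spanV' dim_t.
have [K [S [KD _ DSK]]] := left_inverse_split DinvD dim_t.
have [L [M [UL ML UULM]]] := right_inverse_split UUinv dim_t.
have spanVKU : spanning (col_mx (V' *m Dinv) (col_mx K U)).
  rewrite -DSK; apply: row_combD; last by auto 12 with row_comb.
  apply: row_comb_mull; apply: row_comb_trans (row_comb_spanning Dinv spanV') _.
  have UDDinv : U *m D *m Dinv = U - U *m S *m K.
    by rewrite -[X in X - _]mulmx1 -DSK mulmxDr !mulmxA addrK.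
  by rewrite mul_col_mx UDDinv; auto 12 with row_comb.
pose H := col_mx (0 : 'M_(d.+1, t)) (V' *m Dinv) *m L.
have spanHT : spanning (col_mx H (K *m L)).
  rewrite -ML; apply: row_comb_mull.
  apply: row_comb_trans (row_comb_spanning L spanVKU) _.
  by rewrite /H !mul_col_mx UL; auto 12 with row_comb.
have [c [u [Vc uc]]] := primitive_annihilator (V' *m Dinv *m L) (leq_addl d m').
have Hc : H *m c = 0 by rewrite /H !mul_col_mx Vc !mul0mx col_mx0.
have [F spanF] := spanning_perturbation Hc uc spanHT.
exists (col_mx 0 (V' *m Dinv) + F *m K).
  by rewrite mulmxDl mul_col_mx mul0mx -!mulmxA KD DinvD mulmx0 addr0 mulmx1.
by apply: spanning_of_quotient UULM _; rewrite mulmxDl -mulmxA.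
Qed.

(** * Smith forms of D U + x *)

Definition divisibility_chain (K : comNzRingType) m (g : 'rV[K]_m) : Prop :=
  forall i j : 'I_m, (i <= j)%N -> rdvd (g 0 i) (g 0 j).

Lemma divisibility_chain_scale (K : comNzRingType) d m (z : K) (g : 'rV[K]_m) :
  divisibility_chain g -> divisibility_chain (row_mx (const_mx z : 'rV_d) (z *: g)).
Proof.
move=> chain i j; case: (split_ordP i) => i' ->; case: (split_ordP j) => j' ->;
  rewrite ?row_mxEl ?row_mxEr !mxE /=.
- by exists 1; rewrite mul1r.
- by exists (g 0 j'); rewrite mulrC.
- by rewrite leqNgt ltn_addr.
- by rewrite leq_add2l => /chain [c ->]; exists c; rewrite mulrCA.
Qed.

(* The two spanning matrices are the base changes that take B to the diagonal
   matrix (1, g): the cokernel of B is the direct sum of the cyclic modules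
   K / (g_i) generated by the rows of V. *)
Definition smith_generators (K : comNzRingType) t m (B : 'M[K]_t) (V : 'M[K]_(m, t)) :
  Prop :=
  exists (k : nat) (g : 'rV[K]_m) (X1 : 'M[K]_(k, t)) (X2 : 'M[K]_(m, t)),
    [/\ (k + m = t)%N, spanning (col_mx X1 X2), spanning (col_mx (X1 *m B) V),
        X2 *m B = diag_mx g *m V & divisibility_chain g].

Lemma smith_generators_spanning (K : comNzRingType) t m (B : 'M[K]_t)
    (V : 'M[K]_(m, t)) : smith_generators B V -> spanning (col_mx V B).
Proof.
move=> [k [g [X1 [X2 [_ _ spanXV _ _]]]]].
by apply: row_comb_trans spanXV _; auto 12 with row_comb.
Qed.

Lemma smith_generators_SNF (K : comUnitRingType) t m (B : 'M[K]_t)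
    (V : 'M[K]_(m, t)) : smith_generators B V -> has_SNF B.
Proof.
move=> [k [g [X1 [X2 [dim_k [NX NXE] [NV NVE] X2B chain]]]]].
case: t / dim_k B V X1 X2 NX NXE NV NVE X2B => B V X1 X2 NX NXE NV NVE X2B.
have XBE : col_mx X1 X2 *m B *m NV = block_mx 1%:M 0 0 (diag_mx g).
  have -> : col_mx X1 X2 *m B =
      block_mx 1%:M 0 0 (diag_mx g) *m col_mx (X1 *m B) V.
    by rewrite mul_block_col mul_col_mx X2B !mul0mx mul1mx addr0 add0r.
  by rewrite -mulmxA (mulmx1C (esym NVE)) mulmx1.
exists (col_mx X1 X2), NV; rewrite XBE; split.
- by case: (mulmx1_unit (esym NXE)).
- by case: (mulmx1_unit (esym NVE)).
- by rewrite is_diag_block_mx // !eqxx scalar_mx_is_diag diag_mx_is_diag.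
- move=> i j; case: (split_ordP i) => i' ->; case: (split_ordP j) => j' ->;
    rewrite ?block_mxEul ?block_mxEdr !mxE !eqxx !mulr1n /=.
  + by exists 1; rewrite mulr1.
  + by exists (g 0 j'); rewrite mulr1.
  + by rewrite leqNgt ltn_addr.
  + by rewrite leq_add2l => /chain.
Qed.

Lemma smith_generators_scalar (K : comNzRingType) t (z : K) :
  smith_generators (z%:M : 'M[K]_t) 1%:M.
Proof.
exists 0%N, (const_mx z), 0, 1%:M; split; auto 12 with row_comb.
- by rewrite mul1mx mulmx1 diag_const_mx.
- by move=> i j _; exists 1; rewrite !mxE mul1r.
Qed.

(* In a basis (Vb, Va, U) of K^t the matrix D U + z is block triangular with
   diagonal blocks z, z and U D + z; the off-diagonal block V' lets a Smith
   form of U D + z absorb the second z into its diagonal entries. *)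
Lemma smith_generators_step (K : comNzRingType) t' t m' d (z : K)
    (U : 'M[K]_(t', t)) (D : 'M[K]_(t, t')) (V' : 'M[K]_(m', t'))
    (V : 'M[K]_(d + m', t)) :
  smith_generators (U *m D + z%:M) V' -> V *m D = col_mx 0 V' ->
  spanning (col_mx V U) -> (t' + (d + m') = t)%N ->
  smith_generators (D *m U + z%:M) V.
Proof.
move=> [k' [g' [X1' [X2' [dim_k spanX' spanV' X2B' chain]]]]] VD spanVU dim_t.
set B' := U *m D + z%:M in spanV' X2B'; set B := D *m U + z%:M.
have UB : U *m B = B' *m U by rewrite mulmxDr mulmxDl mulmxA scalar_mxC.
move: VD spanVU; rewrite -[V]vsubmxK; set Vb := usubmx V; set Va := dsubmx V.
rewrite mul_col_mx => /eq_col_mx[VbD VaD] spanVU.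
have VbB : Vb *m B = z *: Vb by rewrite mulmxDr mulmxA VbD mul0mx add0r mul_mx_scalar.
have VaB : Va *m B = V' *m U + z *: Va by rewrite mulmxDr mulmxA VaD mul_mx_scalar.
exists (m' + k')%N, (row_mx (const_mx z) (z *: g')),
  (col_mx Va (X1' *m U)), (col_mx Vb (diag_mx g' *m Va - X2' *m U)).
split.
- by rewrite -dim_t -dim_k; lia.
- apply: row_comb_trans spanVU (col_mx_row_comb _ _); first by auto 12 with row_comb.
  apply: row_comb_trans (row_comb_spanning U spanX') _; rewrite mul_col_mx.
  rewrite -[X2' *m U in X in row_comb X](subKr (diag_mx g' *m Va)).
  by auto 12 with row_comb.
- rewrite mul_col_mx VaB -mulmxA UB mulmxA.
  apply: row_comb_trans spanVU (col_mx_row_comb _ _); first by auto 12 with row_comb.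
  apply: row_comb_trans (row_comb_spanning U spanV') _; rewrite mul_col_mx.
  rewrite -[V' *m U in X in row_comb X](addrK (z *: Va)).
  by auto 12 with row_comb.
- rewrite diag_mx_row mul_col_mx mul_block_col !mul0mx addr0 add0r.
  rewrite VbB mulmxBl -!mulmxA VaB UB mulmxA X2B' mulmxDr !mulmxA addrAC subrr add0r.
  rewrite diag_const_mx mul_scalar_mx; congr col_mx.
  by rewrite -scalemxAr linearZ -scalemxAl.
- exact: divisibility_chain_scale.
Qed.

Local Notation "A ^z" := (map_mx intr A) (at level 8, format "A ^z") : ring_scope.

(* For y = 'X the cokernel of A + y is Z^t, with 'X acting by - A. *)
Definition charmx_smith_generators t m (A : 'M[int]_t) (V : 'M[int]_(m, t)) : Prop :=
  forall (K : comNzRingType) (y : K), smith_generators (A^z + y%:M) V^z.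

Lemma charmx_smith_generators_spanning t m (A : 'M[int]_t) (V : 'M[int]_(m, t)) :
  charmx_smith_generators A V -> spanning (col_mx V A).
Proof.
have intz_mx n p (B : 'M[int]_(n, p)) : B^z = B.
  by apply/matrixP=> i j; rewrite mxE intz.
by move=> /(_ int 0)/smith_generators_spanning; rewrite !intz_mx raddf0 addr0.
Qed.

Lemma charmx_smith_generators_scalar t (r : int) :
  charmx_smith_generators (r%:M : 'M[int]_t) 1%:M.
Proof.
by move=> K y; rewrite map_scalar_mx -raddfD map_mx1; apply: smith_generators_scalar.
Qed.

Lemma charmx_smith_generators_step t' t m' d (r : int) (U : 'M[int]_(t', t))
    (D : 'M[int]_(t, t')) (V' : 'M[int]_(m', t')) (V : 'M[int]_(d + m', t)) :
  charmx_smith_generators (U *m D) V' -> V *m D = col_mx 0 V' ->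
  spanning (col_mx V U) -> (t' + (d + m') = t)%N ->
  charmx_smith_generators (D *m U + r%:M) V.
Proof.
move=> genV' VD spanVU dim_t K y.
have := genV' K (r%:~R + y); rewrite map_mxM => {}genV'.
rewrite map_mxD map_scalar_mx map_mxM -addrA -raddfD.
apply: smith_generators_step genV' _ _ dim_t.
  by rewrite -map_mxM VD map_col_mx map_mx0.
by rewrite -map_col_mx -[1%:M](map_mx1 (intr : int -> K)); apply: row_comb_map.
Qed.

(* The rows are e_(i+2) - e_0 for i < d, followed by e_0. *)
Definition ones_generators d : 'M[int]_(d + 1, 1 + (1 + d)) :=
  col_mx (row_mx (- const_mx 1) (row_mx 0 1%:M)) (row_mx 1%:M 0).

Lemma const_mx1_block d :
  const_mx 1 = row_mx 1%:M (row_mx 1%:M (const_mx 1)) :> 'rV[int]_(1 + (1 + d)).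
Proof.
have <- : const_mx 1 = 1%:M :> 'M[int]_1 by apply/rowP => i; rewrite !ord1 !mxE.
by rewrite !row_mx_const.
Qed.

Lemma ones_generators_mul d :
  ones_generators d *m (const_mx 1)^T = col_mx 0 1%:M :> 'M_(d + 1, 1).
Proof.
rewrite const_mx1_block !tr_row_mx trmx1 trmx_const mul_col_mx !mul_row_col.
by rewrite !mul1mx !mul0mx mulmx1 add0r addr0 addNr.
Qed.

Lemma ones_generators_spanning d :
  spanning (col_mx (ones_generators d) (const_mx 1 : 'rV_(1 + (1 + d)))).
Proof.
rewrite /ones_generators; set Vb := row_mx _ _; set Va := row_mx 1%:M 0.
have tail_rows : row_mx 0 (row_mx 0 1%:M) = Vb + const_mx 1 *m Va.
  by rewrite mul_mx_row mulmx0 mulmx1 add_row_mx addNr addr0.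
have row1 : row_mx 0 (row_mx 1%:M 0) =
    const_mx 1 - Va - const_mx 1 *m (Vb + const_mx 1 *m Va).
  rewrite -tail_rows [const_mx 1 in X in X - _ - _]const_mx1_block.
  rewrite !mul_mx_row !mulmx0 mulmx1 !opp_row_mx !add_row_mx !oppr0 !addr0.
  by rewrite add_row_mx addr0 !subrr.
have -> : 1%:M =
    col_mx Va (col_mx (row_mx 0 (row_mx 1%:M 0)) (row_mx 0 (row_mx 0 1%:M))).
  rewrite scalar_mx_block /block_mx; congr col_mx.
  by rewrite -block_mxEv block_mxEh col_mx0 -block_mxEv -scalar_mx_block.
by rewrite row1 tail_rows; auto 12 with row_comb.
Qed.

Lemma charmx_smith_generators_const t (r : int) : (1 < t)%N ->
  exists m, m.+1 = t /\
    exists V : 'M[int]_(m, t), charmx_smith_generators (const_mx 1 + r%:M) V.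
Proof.
case: t => [|[|d]] // _; exists (d + 1)%N; split; first by rewrite addn1.
rewrite -[d.+2]/(1 + (1 + d))%N; exists (ones_generators d).
pose U : 'rV[int]_(1 + (1 + d)) := const_mx 1.
have -> : const_mx 1 = U^T *m U.
  by apply/matrixP => i j; rewrite !mxE big_ord1 !mxE mulr1.
apply: charmx_smith_generators_step (ones_generators_mul d)
  (ones_generators_spanning d) _.
  by rewrite [_ *m _]mx11_scalar; apply: charmx_smith_generators_scalar.
by rewrite addn1.
Qed.

Definition strictly_convex (t : nat -> nat) : Prop :=
  forall n, (2 * t n.+1 < t n.+2 + t n)%N.

Lemma charmx_smith_generators_exist (t : nat -> nat) (r : int)
    (U : forall n, 'M[int]_(t n, t n.+1)) (D : forall n, 'M[int]_(t n.+1, t n))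
    m0 (V0 : 'M[int]_(m0, t 0)) :
  (forall n, U n.+1 *m D n.+1 = D n *m U n + r%:M) ->
  (forall n, exists W, U n *m W = 1%:M) -> (forall n, exists W, W *m D n = 1%:M) ->
  (t 0 + m0 < t 1)%N -> strictly_convex t ->
  charmx_smith_generators (U 0 *m D 0) V0 ->
  forall n, exists m (V : 'M[int]_(m, t n)), charmx_smith_generators (U n *m D n) V.
Proof.
move=> UD Uinv Dinv t01 convex genV0 n.
suff [m [_ ?]] : exists m, (t n + m < t n.+1)%N /\ exists V : 'M[int]_(m, t n),
    charmx_smith_generators (U n *m D n) V by exists m.
elim: n => [|n [m' [lt_t [V' genV']]]]; first by exists m0; split; last exists V0.
have [[W UW] [W' WD]] := (Uinv n, Dinv n); pose d := (t n.+1 - (t n + m')).-1.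
have dim_t : (t n + (d.+1 + m') = t n.+1)%N by rewrite /d; lia.
have [V VD spanVU] :=
  lift_generators UW WD (charmx_smith_generators_spanning genV') dim_t.
exists (d.+1 + m')%N; split; first by have := convex n; lia.
by exists V; rewrite UD; apply: charmx_smith_generators_step genV' VD spanVU dim_t.
Qed.

(** * Products of differential posets *)

Section Covers.
Variable P : gposet.
Implicit Types u v : telt P.

Lemma tcovP n (x : elt P n) v :
  reflect (exists2 y : elt P n.+1, cov x y & v = Tagged (elt P) y)
          (tcov (Tagged (elt P) x) v).
Proof.
apply: (iffP existsP) => [[x' /existsP[y /and3P[]]] | [y xy ->]].
  by rewrite eq_Tagged /= => /eqP -> /eqP <-; exists y.
by exists x; apply/existsP; exists y; rewrite !eqxx.
Qed.

Lemma tcov_tagged n (x : elt P n) (y : elt P n.+1) :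
  tcov (Tagged (elt P) x) (Tagged (elt P) y) = cov x y.
Proof.
apply/tcovP/idP => [[y' xy' /eqP] | xy]; last by exists y.
by rewrite eq_Tagged /= => /eqP ->.
Qed.

Lemma tcov_tag u v : tcov u v -> tag v = (tag u).+1.
Proof. by case: u => n x /tcovP[y _ ->]. Qed.

Lemma tcov_irrefl u : tcov u u = false.
Proof. by apply/negbTE/negP => /tcov_tag; lia. Qed.

Definition upper_covers u : seq (telt P) :=
  [seq Tagged (elt P) y | y <- enum (cov (tagged u))].

Definition lower_covers u : seq (telt P) :=
  match u with
  | existT 0 _ => [::]
  | existT n.+1 y => [seq Tagged (elt P) x | x <- enum (cov^~ y)]
  end.

Lemma Tagged_inj n : injective (@Tagged nat n (elt P)).
Proof. by move=> x y /eqP; rewrite eq_Tagged => /eqP. Qed.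

Lemma mem_upper_covers u v : (v \in upper_covers u) = tcov u v.
Proof.
case: u => n x; apply/mapP/tcovP => [[y] | [y xy ->]].
  by rewrite mem_enum => xy ->; exists y.
by exists y; rewrite // mem_enum.
Qed.

Lemma mem_lower_covers u v : (u \in lower_covers v) = tcov u v.
Proof.
case: v => -[|n] y /=; first by apply/esym/negbTE/negP => /tcov_tag.
apply/mapP/idP => [[x] | uy]; first by rewrite mem_enum => xy ->; rewrite tcov_tagged.
case: u uy => m x uy; have /= [em] := tcov_tag uy; subst m.
by exists x; rewrite // mem_enum; move: uy; rewrite tcov_tagged.
Qed.

Lemma upper_covers_uniq u : uniq (upper_covers u).
Proof. by rewrite (map_inj_uniq (@Tagged_inj _)) enum_uniq. Qed.

Lemma lower_covers_uniq u : uniq (lower_covers u).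
Proof. by case: u => -[|n] x //=; rewrite (map_inj_uniq (@Tagged_inj _)) enum_uniq. Qed.

Lemma sum_upper_covers (R : nmodType) (f : telt P -> R) n (x : elt P n) :
  \sum_(v <- upper_covers (Tagged (elt P) x)) f v =
  \sum_(y | cov x y) f (Tagged (elt P) y).
Proof. by rewrite big_map big_enum. Qed.

Definition num_common_upper u v : nat := count (tcov v) (upper_covers u).

Definition num_common_lower u v : nat := count (fun w => tcov w v) (lower_covers u).

Lemma num_common_upper_tagged n (x y : elt P n) :
  num_common_upper (Tagged (elt P) x) (Tagged (elt P) y) =
  #|[pred z : elt P n.+1 | cov x z && cov y z]|.
Proof.
rewrite /num_common_upper count_map -sum1_count big_enum_cond sum1_card.
by apply: eq_card => z; rewrite !inE unfold_in /= tcov_tagged.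
Qed.

Lemma num_common_lower_tagged n (x y : elt P n) :
  num_common_lower (Tagged (elt P) x) (Tagged (elt P) y) = ncommon_down x y.
Proof.
case: n x y => [|n] x y //=.
rewrite /num_common_lower count_map -sum1_count big_enum_cond sum1_card.
by apply: eq_card => z; rewrite !inE unfold_in /= tcov_tagged.
Qed.

Lemma num_common_neq_rank u v : tag u != tag v ->
  num_common_upper u v = 0%N /\ num_common_lower u v = 0%N.
Proof.
move=> neq_uv; split; apply/eqP; rewrite -leqn0 leqNgt -has_count; apply/hasPn => w;
  rewrite ?mem_upper_covers ?mem_lower_covers => /tcov_tag tag_w;
  by apply/negP => /tcov_tag; lia.
Qed.

(* Entrywise, this is the identity D U - U D = r I. *)
Definition commutation_relation r := forall u v : telt P,
  num_common_upper u v = (num_common_lower u v + r * (u == v))%N.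

Lemma card_common_upper r n (x y : elt P n) : commutation_relation r ->
  #|[pred z : elt P n.+1 | cov x z && cov y z]| =
  (ncommon_down x y + r * (x == y))%N.
Proof.
by move=> DU; rewrite -num_common_upper_tagged DU num_common_lower_tagged eq_Tagged.
Qed.

Lemma ncommon_down_refl n (x : elt P n) : ncommon_down x x = ndown x.
Proof. by case: n x => // n x; apply: eq_card => w; rewrite !inE andbb. Qed.

Lemma card_common_upper_refl n (x : elt P n) :
  #|[pred z : elt P n.+1 | cov x z && cov x z]| = #|[pred z : elt P n.+1 | cov x z]|.
Proof. by apply: eq_card => z; rewrite !inE andbb. Qed.

Lemma differential_commutation r : differential r P -> commutation_relation r.
Proof.
move=> [_ _ _ D2 D3] u v; have [euv | neq_uv] := eqVneq (tag u) (tag v); last first.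
  have [-> ->] := num_common_neq_rank neq_uv.
  by rewrite (_ : (u == v) = false) ?muln0 //; apply: contraNF neq_uv => /eqP ->.
case: u v euv => n x [m y] /= enm; subst m.
rewrite num_common_upper_tagged num_common_lower_tagged eq_Tagged /=.
have [<- | neq_xy] := eqVneq x y; last by rewrite muln0 addn0 D2.
by rewrite card_common_upper_refl ncommon_down_refl muln1 D3.
Qed.

Definition has_lower_covers : Prop :=
  forall n (y : elt P n.+1), exists x : elt P n, cov x y.

Lemma commutation_differential r :
  (0 < r)%N -> #|elt P 0| = 1%N -> has_lower_covers ->
  commutation_relation r -> differential r P.
Proof.
move=> r_gt0 card0 bot DU; split=> // n x => [y /negPf neq_xy |].
  by rewrite (card_common_upper _ _ DU) neq_xy muln0 addn0.
rewrite -card_common_upper_refl (card_common_upper _ _ DU) ncommon_down_refl.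
by rewrite eqxx muln1.
Qed.

End Covers.

Lemma count_orb_pred1 (I : eqType) (s : seq I) (p : pred I) (i : I) (b c : bool) :
  uniq s -> ~~ (b && c) ->
  count (fun j => p j && b || (j == i) && c) s = (b * count p s + c * (i \in s))%N.
Proof.
move=> us; case: b; case: c => //= _; rewrite ?mul1n ?mul0n ?addn0 ?add0n.
- by apply: eq_count => j; rewrite andbT andbF orbF.
- by rewrite -count_uniq_mem //; apply: eq_count => j /=; rewrite andbF andbT.
- by rewrite -(count_pred0 s); apply: eq_count => j /=; rewrite !andbF.
Qed.

Section Product.
Variables P Q : gposet.
Local Notation T := (prod_poset P Q).

Definition telt_fst (w : telt T) : telt P := (prod_pair (tagged w)).1.
Definition telt_snd (w : telt T) : telt Q := (prod_pair (tagged w)).2.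

Definition telt_pair (u : telt P) (v : telt Q) : telt T :=
  let n := (tag u + tag v)%N in
  Tagged (elt T) (i := n)
    (Tagged (fun k : 'I_n.+1 => (elt P k * elt Q (n - k))%type)
       (i := @Ordinal n.+1 (tag u) (leq_addr (tag v) (tag u)))
       (tagged u, ecast k (elt Q k) (esym (addKn (tag u) (tag v))) (tagged v))).

Lemma telt_fst_pair u v : telt_fst (telt_pair u v) = u.
Proof. by case: u. Qed.

Lemma telt_snd_pair u v : telt_snd (telt_pair u v) = v.
Proof. by case: v => j b; rewrite /telt_snd /=; case: _ / (esym _). Qed.

Lemma tag_telt_fst_snd w : tag w = (tag (telt_fst w) + tag (telt_snd w))%N.
Proof. by case: w => n [i ab]; rewrite /= subnKC // -ltnS. Qed.

Lemma telt_pair_ext w z : telt_fst w = telt_fst z -> telt_snd w = telt_snd z -> w = z.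
Proof.
move=> e1 e2; have := tag_telt_fst_snd w; rewrite e1 e2 -tag_telt_fst_snd.
case: w z e1 e2 => n [i [a b]] [m [j [c d]]] + + /= enm; subst m.
rewrite /telt_fst /telt_snd /= => e1 e2.
have eij : i = j by apply: val_inj; apply: (congr1 tag e1).
subst j; move/eqP: e1; move/eqP: e2.
by rewrite !eq_Tagged /= => /eqP -> /eqP ->.
Qed.

Lemma telt_pairK w : telt_pair (telt_fst w) (telt_snd w) = w.
Proof. by apply: telt_pair_ext; rewrite ?telt_fst_pair ?telt_snd_pair. Qed.

Lemma eq_telt_pair u v u' v' :
  (telt_pair u v == telt_pair u' v') = (u == u') && (v == v').
Proof.
apply/eqP/andP => [e | [/eqP -> /eqP ->] //]; split; apply/eqP.
  by rewrite -(telt_fst_pair u v) e telt_fst_pair.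
by rewrite -(telt_snd_pair u v) e telt_snd_pair.
Qed.

Lemma tcov_prod (w z : telt T) :
  tcov w z = (tcov (telt_fst w) (telt_fst z) && (telt_snd w == telt_snd z))
          || ((telt_fst w == telt_fst z) && tcov (telt_snd w) (telt_snd z)).
Proof.
have [tag_z | neq_tag] := eqVneq (tag z) (tag w).+1.
  by case: w z tag_z => n x [m y] /= em; subst m; apply: tcov_tagged.
transitivity false; first by apply/negbTE/negP => /tcov_tag/eqP; apply/negP.
apply/esym/negbTE/negP => covs; move/eqP: neq_tag; apply.
rewrite !tag_telt_fst_snd; case/orP: covs => /andP[].
  by move=> /tcov_tag -> /eqP ->; rewrite addSn.
by move=> /eqP -> /tcov_tag ->; rewrite addnS.
Qed.

Lemma tcov_telt_pair u v u' v' :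
  tcov (telt_pair u v) (telt_pair u' v') =
  (tcov u u' && (v == v')) || ((u == u') && tcov v v').
Proof. by rewrite tcov_prod !telt_fst_pair !telt_snd_pair. Qed.

Lemma perm_telt_pair s su sv u v :
  uniq s -> uniq su -> uniq sv -> u \notin su ->
  (forall a b,
     (telt_pair a b \in s) = (a \in su) && (b == v) || (a == u) && (b \in sv)) ->
  perm_eq s ([seq telt_pair a v | a <- su] ++ [seq telt_pair u b | b <- sv]).
Proof.
move=> us usu usv nu mem_s.
have pairIl b : injective (telt_pair^~ b).
  by move=> a a' /eqP; rewrite eq_telt_pair => /andP[/eqP].
have pairIr a : injective (telt_pair a).
  by move=> b b' /eqP; rewrite eq_telt_pair => /andP[_ /eqP].
apply: uniq_perm => //.
  rewrite cat_uniq !map_inj_uniq // usu usv /= andbT; apply/hasPn => _ /mapP[b _ ->].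
  apply/mapP => -[a su_a /eqP]; rewrite eq_telt_pair => /andP[/eqP eua _].
  by rewrite eua su_a in nu.
move=> w; rewrite -[w]telt_pairK; move: (telt_fst w) (telt_snd w) => a b {w}.
rewrite mem_s mem_cat; congr (_ || _).
  apply/andP/mapP => [[su_a /eqP ->] | [a' su_a /eqP]]; first by exists a.
  by rewrite eq_telt_pair => /andP[/eqP -> ->].
apply/andP/mapP => [[/eqP -> sv_b] | [b' sv_b /eqP]]; first by exists b.
by rewrite eq_telt_pair => /andP[-> /eqP ->].
Qed.

Lemma upper_covers_pair u v :
  perm_eq (upper_covers (telt_pair u v))
    ([seq telt_pair a v | a <- upper_covers u] ++
     [seq telt_pair u b | b <- upper_covers v]).
Proof.
apply: perm_telt_pair; rewrite ?upper_covers_uniq ?mem_upper_covers ?tcov_irrefl //.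
by move=> a b; rewrite !mem_upper_covers tcov_telt_pair (eq_sym v) (eq_sym u).
Qed.

Lemma lower_covers_pair u v :
  perm_eq (lower_covers (telt_pair u v))
    ([seq telt_pair a v | a <- lower_covers u] ++
     [seq telt_pair u b | b <- lower_covers v]).
Proof.
apply: perm_telt_pair; rewrite ?lower_covers_uniq ?mem_lower_covers ?tcov_irrefl //.
by move=> a b; rewrite !mem_lower_covers tcov_telt_pair.
Qed.

Lemma sum_upper_covers_pair (R : nmodType) (f : telt T -> R) u v :
  \sum_(w <- upper_covers (telt_pair u v)) f w =
  \sum_(a <- upper_covers u) f (telt_pair a v) +
  \sum_(b <- upper_covers v) f (telt_pair u b).
Proof.
rewrite (perm_big _ (upper_covers_pair u v)) big_cat.
by rewrite (big_map (telt_pair^~ v)) (big_map (telt_pair u)).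
Qed.

Lemma count_telt_pair (f : pred (telt T)) (p : pred (telt P)) (q : pred (telt Q))
    s su sv u v u' v' :
  perm_eq s ([seq telt_pair a v | a <- su] ++ [seq telt_pair u b | b <- sv]) ->
  uniq su -> uniq sv -> ~~ p u' -> ~~ q v' ->
  (forall a b, f (telt_pair a b) = p a && (b == v') || (a == u') && q b) ->
  count f s = ((v == v') * count p su + q v * (u' \in su) +
               ((u == u') * count q sv + p u * (v' \in sv)))%N.
Proof.
move=> /permP -> usu usv npu nqv fE; rewrite count_cat.
rewrite (count_map (telt_pair^~ v)) (count_map (telt_pair u)).
rewrite -!count_orb_pred1 //; first last.
- by apply/negP => /andP[/eqP ->]; apply/negP.
- by apply/negP => /andP[/eqP ->]; apply/negP.
congr (_ + _)%N; apply: eq_count => a /=; rewrite fE //.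
by rewrite orbC andbC [X in _ || X = _]andbC.
Qed.

Lemma num_common_upper_pair u v u' v' :
  num_common_upper (telt_pair u v) (telt_pair u' v') =
  ((v == v') * num_common_upper u u' + tcov v' v * tcov u u' +
   ((u == u') * num_common_upper v v' + tcov u' u * tcov v v'))%N.
Proof.
rewrite -[tcov u u']mem_upper_covers -[tcov v v']mem_upper_covers.
apply: (count_telt_pair (p := tcov u') (q := tcov v') (upper_covers_pair u v));
  rewrite ?upper_covers_uniq ?tcov_irrefl // => a b.
by rewrite tcov_telt_pair (eq_sym u') (eq_sym v').
Qed.

Lemma num_common_lower_pair u v u' v' :
  num_common_lower (telt_pair u v) (telt_pair u' v') =
  ((v == v') * num_common_lower u u' + tcov v v' * tcov u' u +
   ((u == u') * num_common_lower v v' + tcov u u' * tcov v' v))%N.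
Proof.
rewrite -[tcov u' u]mem_lower_covers -[tcov v' v]mem_lower_covers.
apply: (count_telt_pair (p := fun a => tcov a u') (q := fun b => tcov b v')
          (lower_covers_pair u v));
  rewrite ?lower_covers_uniq ?tcov_irrefl // => a b.
by rewrite tcov_telt_pair.
Qed.

Lemma prod_commutation r s :
  commutation_relation P r -> commutation_relation Q s ->
  commutation_relation T (r + s).
Proof.
move=> DUP DUQ w z; rewrite -[w]telt_pairK -[z]telt_pairK.
rewrite num_common_upper_pair num_common_lower_pair DUP DUQ eq_telt_pair -mulnb.
ring.
Qed.

Lemma prod_has_lower_covers :
  has_lower_covers P -> has_lower_covers Q -> has_lower_covers T.
Proof.
move=> coverP coverQ n y.
suff [w] : exists w, tcov w (Tagged (elt T) y).
  case: w => m x /[dup] /tcov_tag /= -[em]; subst m.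
  by rewrite tcov_tagged; exists x.
set w := Tagged _ _; rewrite -[w]telt_pairK.
have := tag_telt_fst_snd w; move: (telt_fst w) (telt_snd w) => [[|i] a] [j b] /=.
  case: j b => [|j] b // _; have [b' bb'] := coverQ _ b.
  exists (telt_pair (Tagged (elt P) a) (Tagged (elt Q) b')).
  by rewrite tcov_telt_pair eqxx tcov_tagged bb' orbT.
move=> _; have [a' aa'] := coverP _ a.
exists (telt_pair (Tagged (elt P) a') (Tagged (elt Q) b)).
by rewrite tcov_telt_pair eqxx tcov_tagged aa'.
Qed.

End Product.

Lemma rksize_prod (P Q : gposet) n :
  rksize (prod_poset P Q) n = (\sum_(i < n.+1) rksize P i * rksize Q (n - i))%N.
Proof.
rewrite /rksize /= card_tagged sumnE big_map big_enum /=.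
by apply: eq_bigr => i _; rewrite card_prod.
Qed.

Lemma prod_differential r s (P Q : gposet) :
  differential r P -> differential s Q -> differential (r + s) (prod_poset P Q).
Proof.
move=> dP dQ; have [r_gt0 P0 coverP _ _] := dP; have [_ Q0 coverQ _ _] := dQ.
apply: commutation_differential.
- by rewrite addn_gt0 r_gt0.
- by have := rksize_prod P Q 0; rewrite big_ord1 /rksize P0 Q0.
- exact: prod_has_lower_covers.
- by apply: prod_commutation; apply: differential_commutation.
Qed.

Lemma down_sections (P : gposet) : down_surjective P ->
  exists sec : forall n, elt P n -> elt P n.+1 -> int,
    forall n (y y' : elt P n), \sum_(x | cov y' x) sec n y x = (y == y')%:R.
Proof.
move=> surjP.
have ex n (y : elt P n) : exists w : {ffun elt P n.+1 -> int},
    [forall y', \sum_(x | cov y' x) w x == (y == y')%:R].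
  have [w wE] := surjP n (fun y' => (y == y')%:R).
  exists [ffun x => w x]; apply/forallP => y'; rewrite wE.
  by apply/eqP/eq_bigr => x _; rewrite ffunE.
exists (fun n y => (xchoose (ex n y) : {ffun _ -> _})) => n y y'.
by have /forallP/(_ y')/eqP := xchooseP (ex n y).
Qed.

(* Solving D_P G = F - D_Q G rank by rank in P: the right-hand side at rank i
   only involves G at rank i of P. *)
Lemma down_sum_surjective (P Q : gposet) (F : telt P -> telt Q -> int) :
  down_surjective P -> exists G : telt P -> telt Q -> int, forall u v,
    \sum_(a <- upper_covers u) G a v + \sum_(b <- upper_covers v) G u b = F u v.
Proof.
move=> /down_sections[sec secE].
pose G := fix G i : elt P i -> telt Q -> int :=
  match i with
  | 0 => fun _ _ => 0
  | k.+1 => fun x v => \sum_y sec k y x *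
      (F (Tagged (elt P) y) v - \sum_(b <- upper_covers v) G k y b)
  end.
exists (fun u => G (tag u) (tagged u)) => -[i x] v.
rewrite sum_upper_covers /= exchange_big /=.
under eq_bigr => y _ do rewrite -mulr_suml secE.
rewrite (bigD1 x) //= eqxx mul1r [X in _ + X + _]big1 => [|y /negPf neq_yx].
  by rewrite addr0 subrK.
by rewrite neq_yx mul0r.
Qed.

Lemma prod_down_surjective (P Q : gposet) :
  down_surjective P \/ down_surjective Q -> down_surjective (prod_poset P Q).
Proof.
move=> surj n f; pose F u v := untag 0 (i := n) f (@telt_pair P Q u v).
have [G GF] : exists G : telt P -> telt Q -> int, forall u v,
    \sum_(a <- upper_covers u) G a v + \sum_(b <- upper_covers v) G u b = F u v.
  case: surj => [|surjQ]; first exact: down_sum_surjective.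
  have [G GF] := down_sum_surjective (fun v u => F u v) surjQ.
  by exists (fun u v => G v u) => u v; rewrite -GF addrC.
pose T := prod_poset P Q; pose g (w : telt T) := G (telt_fst w) (telt_snd w).
exists (fun z => g (Tagged (elt T) z)) => x; rewrite -(sum_upper_covers g).
set w : telt T := Tagged (elt T) x.
have -> : f x = F (telt_fst w) (telt_snd w).
  by rewrite /F telt_pairK (untagE 0 f (erefl : tag w = n)).
rewrite -GF -[w in RHS]telt_pairK sum_upper_covers_pair.
by congr (_ + _); apply: eq_bigr => a _; rewrite /g telt_fst_pair telt_snd_pair.
Qed.

(** * Rank sizes and matrices of differential posets *)

Section RankSizes.
Variables (r : nat) (P : gposet).
Hypothesis diffP : differential r P.

Lemma differential_gt0 : (0 < r)%N.
Proof. by case: diffP. Qed.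

Lemma rksize0 : rksize P 0 = 1%N.
Proof. by case: diffP. Qed.

Lemma cov_bottom (x : elt P 0) (y : elt P 1) : cov x y.
Proof.
have [_ _ bot _ _] := diffP; have [x' x'y] := bot 0%N y.
by rewrite -(fintype_le1P (eq_leq rksize0) x x').
Qed.

Lemma rksize_gt0 n : (0 < rksize P n)%N.
Proof.
have [_ _ _ _ D3] := diffP; elim: n => [|n /card_gt0P[x _]]; first by rewrite rksize0.
have : (0 < #|[pred z : elt P n.+1 | cov x z]|)%N.
  by rewrite D3 ltn_addl ?differential_gt0.
by case/card_gt0P => z _; apply/card_gt0P; exists z.
Qed.

Lemma rksize1 : rksize P 1 = r.
Proof.
have [_ _ _ _ D3] := diffP; have /card_gt0P[x _] := rksize_gt0 0.
by rewrite -[r]add0n -(D3 0%N x); apply: eq_card => z; rewrite !inE cov_bottom.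
Qed.

Lemma rksize2 : (r < rksize P 2)%N.
Proof.
have [_ _ _ _ D3] := diffP; have /card_gt0P[x _] := rksize_gt0 1.
have ndown1 : ndown x = 1%N.
  by apply: etrans rksize0; apply: eq_card => z; rewrite !inE cov_bottom.
by have := D3 1%N x; rewrite ndown1 add1n => <-; apply: max_card.
Qed.

End RankSizes.

Section UpMatrix.
Variable P : gposet.

Definition upmx n : 'M[int]_(#|elt P n|, #|elt P n.+1|) :=
  \matrix_(i, j) (cov (enum_val i) (enum_val j))%:R.

Lemma sum_enum_val (R : nmodType) (T : finType) (F : T -> R) :
  \sum_(i < #|T|) F (enum_val i) = \sum_x F x.
Proof. by rewrite -(big_enum_val F); apply: eq_bigl. Qed.

Lemma sum_natr_andb (R : pzSemiRingType) (T : finType) (a b : pred T) :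
  \sum_x (a x)%:R * (b x)%:R = #|[pred x | a x && b x]|%:R :> R.
Proof.
rewrite -sum1_card natr_sum [RHS]big_mkcond; apply: eq_bigr => x _.
by rewrite inE -natrM mulnb; case: (_ && _).
Qed.

Lemma upmx_mul_tr n i j : (upmx n *m (upmx n)^T) i j =
  (#|[pred z : elt P n.+1 | cov (enum_val i) z && cov (enum_val j) z]|)%:R.
Proof.
rewrite mxE -sum_natr_andb -[RHS]sum_enum_val.
by apply: eq_bigr => k _; rewrite !mxE.
Qed.

Lemma tr_upmx_mul n i j :
  ((upmx n)^T *m upmx n) i j = (ncommon_down (enum_val i) (enum_val j))%:R.
Proof.
rewrite mxE -(sum_natr_andb _ (fun w => cov w (enum_val i))) -[RHS]sum_enum_val.
by apply: eq_bigr => k _; rewrite !mxE.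
Qed.

Lemma upmx_mul_tr0 r : commutation_relation P r ->
  upmx 0 *m (upmx 0)^T = (r%:Z)%:M.
Proof.
move=> DU; apply/matrixP => i j.
rewrite upmx_mul_tr (card_common_upper _ _ DU) mxE.
by rewrite (inj_eq enum_val_inj) add0n natrM mulr_natr !natz.
Qed.

Lemma upmx_mul_trS r n : commutation_relation P r ->
  upmx n.+1 *m (upmx n.+1)^T = (upmx n)^T *m upmx n + (r%:Z)%:M.
Proof.
move=> DU; apply/matrixP => i j; rewrite [RHS]mxE upmx_mul_tr tr_upmx_mul mxE.
rewrite (card_common_upper _ _ DU) (inj_eq enum_val_inj) natrD.
by rewrite natrM mulr_natr !natz.
Qed.

Lemma upmx_tr_left_inverse n : down_surjective P -> exists W, W *m (upmx n)^T = 1%:M.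
Proof.
move=> /down_sections[sec secE].
exists (\matrix_(i, j) sec n (enum_val i) (enum_val j)).
apply/matrixP => i j; rewrite !mxE -(inj_eq enum_val_inj) -secE [RHS]big_mkcond.
rewrite -[RHS]sum_enum_val; apply: eq_bigr => k _; rewrite !mxE.
by case: cov; rewrite ?mulr1 ?mulr0.
Qed.

Lemma upmx_right_inverse n : down_surjective P -> exists W, upmx n *m W = 1%:M.
Proof.
move=> /upmx_tr_left_inverse-/(_ n)[W WU]; exists W^T.
by rewrite -[upmx n]trmxK -trmx_mul WU trmx1.
Qed.

Lemma DUmxE n : DUmx P n = map_mx intr (upmx n *m (upmx n)^T).
Proof. by apply/matrixP => i j; rewrite [RHS]mxE upmx_mul_tr mxE rmorph_nat. Qed.

End UpMatrix.

Lemma gram_ge0 n (v : 'cV[int]_n) : 0 <= (v^T *m v) 0 0.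
Proof. by rewrite mxE; apply: sumr_ge0 => i _; rewrite mxE -expr2 sqr_ge0. Qed.

Lemma gram_eq0 n (v : 'cV[int]_n) : (v^T *m v) 0 0 = 0 -> v = 0.
Proof.
move/eqP; rewrite mxE psumr_eq0 => [/allP v_eq0|i _].
  apply/colP => i; have := v_eq0 i (mem_index_enum i).
  by rewrite !mxE -expr2 sqrf_eq0 => /eqP.
by rewrite mxE -expr2 sqr_ge0.
Qed.

(* A vector c killed by U^T satisfies |N c|^2 + r |c|^2 = 0, hence vanishes. *)
Lemma leq_dim_of_gram k m n (U : 'M[int]_(m, n)) (N : 'M[int]_(k, m)) (r : int) :
  0 < r -> U *m U^T = N^T *m N + r%:M -> (m <= n)%N.
Proof.
move=> r_gt0 UU; rewrite leqNgt; apply/negP => lt_nm.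
have [c [u [Uc uc]]] := primitive_annihilator U^T lt_nm.
have sum0 : ((N *m c)^T *m (N *m c)) 0 0 + r * (c^T *m c) 0 0 = 0.
  transitivity ((c^T *m (U *m U^T *m c)) 0 0); last by rewrite -mulmxA Uc !mulmx0 mxE.
  by rewrite UU mulmxDl mulmxDr mul_scalar_mx -scalemxAr trmx_mul -!mulmxA !mxE.
have c0 : c = 0.
  apply/gram_eq0/eqP; move/eqP: sum0.
  rewrite paddr_eq0 ?mulr_ge0 ?gram_ge0 ?(ltW r_gt0) // mulf_eq0 (gt_eqF r_gt0).
  by case/andP.
by move/matrixP/(_ 0 0): uc; rewrite c0 mulmx0 !mxE.
Qed.

Lemma leq_rksize r (P : gposet) n : differential r P -> (rksize P n <= rksize P n.+1)%N.
Proof.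
move=> dP; have DU := differential_commutation dP.
have r_gt0 : 0 < r%:Z by rewrite ltz_nat (differential_gt0 dP).
case: n => [|n]; last exact: leq_dim_of_gram r_gt0 (upmx_mul_trS n DU).
apply: (leq_dim_of_gram (U := upmx P 0) (N := 0 : 'M_(0, _)) r_gt0).
by rewrite mulmx0 add0r (upmx_mul_tr0 DU).
Qed.

Lemma upmx_bottom r (P : gposet) : differential r P ->
  (upmx P 0)^T *m upmx P 0 = const_mx 1.
Proof.
move=> dP; apply/matrixP => i j; rewrite !mxE.
under eq_bigr => k _ do rewrite !mxE !(cov_bottom dP) mulr1.
by rewrite sumr_const card_ord -/(rksize P 0) (rksize0 dP).
Qed.

Lemma convolution_strictly_convex (p q : nat -> nat) :
  (forall n, 0 < p n)%N -> (forall n, p n <= p n.+1)%N ->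
  q 0%N = 1%N -> (0 < q 1)%N -> (q 1 < q 2)%N ->
  (forall n, 2 * q n.+1 <= q n.+2 + q n)%N ->
  strictly_convex (fun n => \sum_(i < n.+1) p i * q (n - i))%N.
Proof.
move=> p_gt0 p_le q0 q1_gt0 q12 q_convex n.
pose S m := (\sum_(i < n) p i * q (m + (n - i)))%N.
have SE m : (\sum_(i < n) p i * q (m + n - i) = S m)%N.
  by apply: eq_bigr => i _; rewrite addnBA // ltnW.
have -> : (\sum_(i < n.+1) p i * q (n - i) = S 0%N + p n)%N.
  by rewrite big_ord_recr /= -[X in (X + _)%N](SE 0%N) subnn q0 muln1.
have -> : (\sum_(i < n.+2) p i * q (n.+1 - i) = S 1%N + p n * q 1 + p n.+1)%N.
  by rewrite !big_ord_recr /= -(SE 1%N) subnn subSnn q0 muln1.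
have -> : (\sum_(i < n.+3) p i * q (n.+2 - i) =
           S 2 + p n * q 2 + p n.+1 * q 1 + p n.+2)%N.
  rewrite !big_ord_recr /= -(SE 2%N) subnn subSnn q0 muln1.
  by have -> : (n.+2 - n = 2)%N by lia.
have S_convex : (2 * S 1%N <= S 2 + S 0)%N.
  rewrite big_distrr -big_split /=; apply: leq_sum => i _.
  by rewrite mulnCA -mulnDr leq_mul.
have pq2 : (p n * (2 * q 1) <= p n * (q 2 + 1))%N.
  by rewrite leq_mul //; have := q_convex 0%N; rewrite q0.
have [q1_le1 | q1_gt1] := leqP (q 1%N) 1%N.
  have q1 : q 1%N = 1%N by lia.
  have pq2_gt : (p n * 2 <= p n * q 2)%N by rewrite leq_mul //; lia.
  by move: (p_gt0 n) (p_le n.+1); rewrite q1; lia.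
have pq1 : (p n.+1 * 2 <= p n.+1 * q 1)%N by rewrite leq_mul.
by have := p_gt0 n.+2; lia.
Qed.

Lemma charmx_smith_generators_rank1 r (P : gposet) : differential r P -> (1 < r)%N ->
  exists m, m.+1 = rksize P 1 /\ exists V : 'M[int]_(m, rksize P 1),
    charmx_smith_generators (upmx P 1 *m (upmx P 1)^T) V.
Proof.
move=> dP r_gt1; have DU := differential_commutation dP.
rewrite (upmx_mul_trS 0 DU) (upmx_bottom dP).
by apply: charmx_smith_generators_const; rewrite (rksize1 dP).
Qed.

Lemma DUmx_has_SNF r (P : gposet) :
  differential r P -> (1 < r)%N -> down_surjective P -> strictly_convex (rksize P) ->
  forall n, has_SNF (DUmx P n + ('X)%:M).
Proof.
move=> dP r_gt1 surjP convex n; have DU := differential_commutation dP.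
suff [m [V genV]] : exists m (V : 'M[int]_(m, rksize P n)),
    charmx_smith_generators (upmx P n *m (upmx P n)^T) V.
  by rewrite DUmxE; apply: smith_generators_SNF (genV _ _).
case: n => [|n].
  exists (rksize P 0), 1%:M; rewrite (upmx_mul_tr0 DU).
  exact: charmx_smith_generators_scalar.
have [m1 [em1 [V1 genV1]]] := charmx_smith_generators_rank1 dP r_gt1.
apply: (charmx_smith_generators_exist (t := fun k => rksize P k.+1)
  (U := fun k => upmx P k.+1) (D := fun k => (upmx P k.+1)^T) _ _ _ _ _ genV1).
- by move=> k; apply: upmx_mul_trS.
- by move=> k; apply: upmx_right_inverse.
- by move=> k; apply: upmx_tr_left_inverse.
- by have := convex 0%N; rewrite (rksize0 dP); lia.
- by move=> k; apply: convex.
Qed.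

Theorem mainTheorem7 (r s : nat) (P Q : gposet)
  (hP : differential r P) (hQ : differential s Q)
  (hq : forall n : nat, (2 <= n)%N ->
     ((rksize Q n)%:Z - (rksize Q n.-1)%:Z >=
      (rksize Q n.-1)%:Z - (rksize Q n.-2)%:Z)%R)
  (hsurj : down_surjective P \/ down_surjective Q) :
  forall n : nat, has_SNF (DUmx (prod_poset P Q) n + ('X)%:M)%R.
Proof.
apply: (DUmx_has_SNF (prod_differential hP hQ)).
- by move: (differential_gt0 hP) (differential_gt0 hQ); lia.
- exact: prod_down_surjective.
move=> n; rewrite !rksize_prod; apply: convolution_strictly_convex => [k|k||||k].
- exact: rksize_gt0 hP k.
- exact: leq_rksize k hP.
- exact: rksize0 hQ.
- by rewrite (rksize1 hQ) (differential_gt0 hQ).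
- by rewrite (rksize1 hQ) (rksize2 hQ).
- by have /= := hq k.+2 isT; lia.
Qed.
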